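(* (1) For $G=\mathbb{Z}_2\times\mathbb{Z}_2$, the set of values of the group determinant $\mathscr{D}_G$ at integer arguments is exactly $$\{4m+1: m\in\mathbb{Z}\}\cup\{2^4(2m+1): m\in\mathbb{Z}\}\cup\{2^6m: m\in\mathbb{Z}\}.$$ (2) For $G=D_8$, the set of values of $\mathscr{D}_G$ at integer arguments is exactly $\{4m+1: m\in\mathbb{Z}\}\cup\{2^8m: m\in\mathbb{Z}\}$. (3) For $G=D_{16}$, the set of values of $\mathscr{D}_G$ at integer arguments is exactly $\{4m+1: m\in\mathbb{Z}\}\cup\{2^{10}m: m\in\mathbb{Z}\}$. (4) For $G=D_{2^k}$ with $k\ge 4$, the odd values of $\mathscr{D}_G$ at integer arguments are exactly the integers congruent to $1$ mod $4$. The set $\mathscr{E}$ of even values of $\mathscr{D}_G$ at integer arguments satisfies $$2^{3k}\mathbb{Z}\subseteq\mathscr{E}\subseteq 2^{2k+2}\mathbb{Z},$$ and $\mathscr{E}$ contains values exactly divisible by $2^{2k+2}$ (i.e. divisible by $2^{2k+2}$ but not by $2^{2k+3}$).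
   Context: For a finite group $G=\{g_1,\ldots,g_N\}$ and variables $x_g$ ($g\in G$), the group determinant is the $N\times N$ determinant $\mathscr{D}_G(x_{g_1},\ldots,x_{g_N})=\det\left(x_{g_ig_j^{-1}}\right)_{1\le i,j\le N}$; integer arguments means $(x_{g_1},\ldots,x_{g_N})\in\mathbb{Z}^N$. $\mathbb{Z}_2$ is the cyclic group of order $2$. $D_{2n}=\langle R,F \mid R^n=1,\ F^2=1,\ RF=FR^{n-1}\rangle$ denotes the dihedral group of order $2n$ (the subscript is the order of the group, so $D_8$, $D_{16}$, $D_{2^k}$ have orders $8$, $16$, $2^k$). *)

(* Defs.v *)
From mathcomp Require Import all_boot all_order all_fingroup all_algebra all_solvable.

Set Implicit Arguments.
Unset Strict Implicit.
Unset Printing Implicit Defensive.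

Local Open Scope group_scope.

(* The enumeration g_1, ..., g_N is that of enum_val; its choice is immaterial,
   since another one only conjugates the matrix by a permutation matrix. *)
Definition group_det (gT : finGroupType) (x : gT -> int) : int :=
  (\det (\matrix_(i < #|gT|, j < #|gT|)
           x (enum_val i * (enum_val j)^-1)%g))%R.

Definition group_det_value (gT : finGroupType) (v : int) : Prop :=
  exists x : gT -> int, v = group_det x.

Definition even_group_det_value (gT : finGroupType) (v : int) : Prop :=
  group_det_value gT v /\ (2 %| v)%Z.

(* The group law on the additive type 'Z_2 is addition. *)
Definition klein_four : finGroupType := ('Z_2 * 'Z_2)%type.

(* The library presents 'D_(2n) by x ^ y = x^-1 rather than R F = F R^(n-1). *)
Lemma dihedral_presentation (n : nat) : 1 < n ->
  'D_(2 * n) \isog Grp (R : F : R ^+ n, F ^+ 2, R * F = F * R ^+ n.-1).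
Proof.
move=> n_gt1; rewrite mul2n => gT H.
rewrite (Grp_dihedral n_gt1); apply/existsP/existsP => -[[x y]] /=.
  move=> /eqP[defH xn y2 xy]; exists (x, y); rewrite /= !xpair_eqE.
  rewrite defH xn y2 !eqxx /= (conjgC x y) xy.
  by rewrite -[x ^+ _]mul1g -(mulVg x) -mulgA -expgS prednK ?xn ?mulg1 ?(ltnW n_gt1).
move=> /eqP[defH xn y2 xy]; exists (x, y); rewrite /= !xpair_eqE.
rewrite defH xn y2 !eqxx /= conjgE xy mulKg.
by rewrite eq_sym eq_invg_mul -expgS prednK ?xn ?(ltnW n_gt1).
Qed.

(* Main.v *)
Require Import Defs.
From mathcomp Require Import all_boot all_order all_fingroup all_algebra all_solvable.
From mathcomp Require Import all_field.
From mathcomp Require Import zify ring.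

(** Write an element of the integral group ring of the dihedral group of order
2n as f(R) + g(R) F.  The regular representation splits along the characters
of the rotation subgroup into 2 x 2 blocks, so the group determinant is the
product over the n-th roots of unity w of
  H(w) = f(w) f(w^-1) - g(w) g(w^-1)
(dihedral_det_value).  As H is invariant under w -> w^-1, it is a polynomial h
with integer coefficients in w + w^-1.

Let n = 2^(s+1) with s > 0.  The roots w = 1 and w = -1 contribute h(2) h(-2), which is
the group determinant of the Klein four-group at the sums of f and g over
even and odd exponents.  A primitive root of order 2^(j+2) and its inverse
contribute the same value, hence the roots of that order contribute a square
C_j^2, where C_j is the product of the conjugates of h(w + w^-1) in the real
cyclotomic field.  That product is computed inside the integers: pairing c with
-c gives h(c) h(-c) = (Gh)(c^2 - 2) for an integer polynomial Gh
(horner_graeffe), so that C_j is the value at 0 of the j-th iterate of G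
(prod_odd_powers).  Moreover Gh and h take congruent values modulo 2, so the
Klein factor and all the C_j have the same parity.

Upper bounds (dihedral_value_necessary).  If the common parity is odd, each
C_j^2 and the Klein factor are 1 modulo 4.  If it is even, every C_j^2 gives
a factor 4, and the Klein factor is divisible by 2^6 or is 2^4 times an odd
number; in the second case the four coefficient sums have the same parity, and
then C_0 = |f(i)|^2 - |g(i)|^2 is divisible by 4.  Either way
2^(2s+6) divides the determinant, which is 2^(2k+2) for the group of order 2^k.

Attained values.  Adding t (1 + x + ... + x^(n-1)) to both f and g only changes
the factor at w = 1, where f(1) + g(1) becomes f(1) + g(1) + 2nt
(dihedral_value_shift).  A single pair (f, g) thus gives a whole arithmetic
progression, and the theorem follows from a few pairs for which the product P
of H over w <> 1 is explicit:
  f = 1 + ... + x^(2m), g = 1 + ... + x^(2m-1): H is a cyclotomic unit, P = 1;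
  f = 1 + x^2, g = -(1 + x): H(w) = (1 - w)(1 - w^3) / w^2, P = n^2;
  f = 3 + x, g = 0: the determinant is (3^n - 1)^2;
and a few pairs for n = 4 and n = 8, where P comes from h. *)

Set Implicit Arguments.
Unset Strict Implicit.
Unset Printing Implicit Defensive.
Import Order.TTheory GRing.Theory Num.Theory.
Local Open Scope ring_scope.

Local Notation ZtoC := (intr : int -> algC).
Local Notation pZtoC := (map_poly ZtoC).

(** * Group determinants and block matrices *)

Lemma group_det_reindex (gT : finGroupType) (x : gT -> int) (m : nat)
    (e : 'I_m -> gT) : injective e -> m = #|gT| ->
  group_det x = \det (\matrix_(i, j) x (e i * (e j)^-1)%g).
Proof.
move=> inj_e Em; subst m.
have inj_s : injective (enum_rank \o e).
  by apply: inj_comp inj_e; apply: enum_rank_inj.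
pose s := perm inj_s.
rewrite /group_det; set M := (X in \det X = _).
have -> : \matrix_(i, j) x (e i * (e j)^-1)%g = row_perm s (col_perm s M).
  by apply/matrixP=> i j; rewrite !mxE !permE /= !enum_rankK.
rewrite row_permE col_permE !det_mulmx !det_perm odd_permV mulrCA.
by rewrite -signr_addb addbb mulr1.
Qed.

(** The factorization
[A, B; C, D] [D, 0; -C, 1] = [AD - BC, B; 0, D] proves this up to a factor
\det D, which need not be regular.  Replacing D by 'X + D over {poly R} makes
its determinant monic; evaluation at 0 recovers the claim. *)
Lemma det_block_commute (R : idomainType) (n : nat) (A B C D : 'M[R]_n) :
  C *m D = D *m C -> \det (block_mx A B C D) = \det (A *m D - B *m C).
Proof.
move=> CD.
pose P (M : 'M[R]_n) := map_mx (@polyC R) M.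
pose D' := 'X%:M + P D.
have D'_neq0 : \det D' != 0.
  have -> : D' = char_poly_mx (- D).
    by rewrite /char_poly_mx map_mxN opprK.
  exact/monic_neq0/char_poly_monic.
have CD' : P C *m D' = D' *m P C.
  by rewrite mulmxDl mulmxDr scalar_mxC -!map_mxM CD.
have main : \det (block_mx (P A) (P B) (P C) D') = \det (P A *m D' - P B *m P C).
  apply: (mulIf D'_neq0); rewrite -[in LHS](mul1r (\det D')) -[in LHS](det1 _ n).
  rewrite mulrA.
  have -> : \det (block_mx (P A) (P B) (P C) D') * \det (1%:M : 'M_n) * \det D'
     = \det (block_mx (P A) (P B) (P C) D' *m block_mx D' 0 (- P C) 1%:M).
    by rewrite det_mulmx det_lblock det1 !mulr1.
  rewrite mulmx_block !mulmx0 !mulmx1 !add0r !mulmxN CD' subrr.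
  by rewrite det_ublock.
have ev (M : 'M[{poly R}]_n) : (\det M).[0] = \det (map_mx (horner_eval 0) M).
  by rewrite det_map_mx.
have evP M : map_mx (horner_eval 0) (P M) = M.
  by apply/matrixP=> i j; rewrite !mxE /horner_eval hornerC.
have evD : map_mx (horner_eval 0) D' = D.
  rewrite map_mxD evP map_scalar_mx /= /horner_eval hornerX.
  by rewrite raddf0 add0r.
have /(congr1 (horner_eval 0)) := main.
rewrite -!det_map_mx map_block_mx !evP evD => ->.
by rewrite map_mxB !map_mxM !evP evD.
Qed.

(** * Dihedral groups *)

Section Dihedral.
Local Open Scope group_scope.

Lemma dihedral_elements (n : nat) : (1 < n)%N ->
  exists x y : 'D_(2 * n), [/\ x ^+ n = 1, y * y = 1, x ^ y = x^-1
    & forall h, exists i : 'I_n, h = x ^+ i \/ h = y * x ^+ i].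
Proof.
move=> n_gt1; have Grp2 := Grp_dihedral n_gt1; rewrite -mul2n in Grp2.
have [_] := isoGrpP [group of 'D_(2 * n)] Grp2 (isog_refl _).
case/existsP=> -[x y] /= /eqP[defG xn y2 xy].
exists x, y; split=> // h.
have nxy : <[y]> \subset 'N(<[x]>).
  by rewrite norms_cycle xy groupV cycle_id.
have: h \in <[x]> <*> <[y]> by rewrite [_ <*> _]defG in_setT.
rewrite norm_joinEr // -(normC nxy) => /mulsgP[_ _ /cycleP[j ->] /cycleP[i ->] ->].
have n_gt0 := ltnW n_gt1.
exists (Ordinal (ltn_pmod i n_gt0)); rewrite /= expg_mod //.
rewrite (divn_eq j 2) expgD (mulnC _ 2) expgM y2 expg1n mul1g modn2.
by case: (odd j); [right; rewrite expg1 | left; rewrite mul1g].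
Qed.

(** Rotations are listed before reflections, the reflections as y * x ^+ i: with
this choice the four blocks of the group matrix are circulant matrices or
transposes of such. *)
Definition dihedral_enum (gT : finGroupType) (x y : gT) n (i : 'I_(n + n)) : gT :=
  match split i with inl i => x ^+ i | inr i => y * x ^+ i end.

Lemma dihedral_enum_inj (n : nat) (x y : 'D_(2 * n)) : (1 < n)%N ->
  (forall h, exists i : 'I_n, h = x ^+ i \/ h = y * x ^+ i) ->
  injective (@dihedral_enum _ x y n).
Proof.
move=> n_gt1 surj; suff /image_injP inj_e : #|codom (@dihedral_enum _ x y n)| == #|'I_(n + n)|.
  by move=> i j; apply: inj_e.
have -> : #|'I_(n + n)| = #|('D_(2 * n))%type|.
  by rewrite card_ord addnn -cardsT mul2n card_dihedral.
apply/eqP/eq_card=> h; rewrite inE; apply/codomP.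
have [i [->|->]] := surj h; [exists (lshift n i) | exists (rshift n i)].
  by rewrite /dihedral_enum (unsplitK (inl i)).
by rewrite /dihedral_enum (unsplitK (inr i)).
Qed.

Lemma expg_Zp_add (gT : finGroupType) (x : gT) (n : nat) (i j : 'I_n.+1) :
  x ^+ n.+1 = 1 -> x ^+ (i + j)%R = x ^+ i * x ^+ j.
Proof. by move=> xn; rewrite /= expg_mod // expgD. Qed.

Lemma expg_Zp_opp (gT : finGroupType) (x : gT) (n : nat) (i : 'I_n.+1) :
  x ^+ n.+1 = 1 -> x ^+ (- i)%R = x ^- i.
Proof.
move=> xn; apply/(mulgI (x ^+ i)).
by rewrite -expg_Zp_add // subrr mulgV.
Qed.
End Dihedral.

Definition circulant (R : Type) (n : nat) (a : 'I_n.+1 -> R) : 'M[R]_n.+1 :=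
  \matrix_(i, j) a (i - j).

Lemma dihedral_det_block (n : nat) (x y : 'D_(2 * n.+1)) (phi : 'D_(2 * n.+1) -> int) :
  (0 < n)%N -> (x ^+ n.+1 = 1)%g -> (y * y = 1)%g -> (x ^ y = x^-1)%g ->
  injective (@dihedral_enum _ x y n.+1) ->
  let a (i : 'I_n.+1) := phi (x ^+ i)%g in
  let b (i : 'I_n.+1) := phi (x ^+ i * y)%g in
  group_det phi = \det (block_mx (circulant a) (circulant b)
                                (circulant b)^T (circulant a)^T).
Proof.
move=> n_gt0 xn y2 xy inj_e a b.
rewrite (group_det_reindex phi inj_e); last by rewrite -cardsT mul2n card_dihedral ?addnn.
have yV : (y^-1 = y)%g by apply/eqP; rewrite eq_invg_mul y2.
have yx i : (y * x ^+ i = x ^- i * y)%g.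
  have xyi : ((x ^+ i) ^ y = x ^- i)%g by rewrite conjXg xy expgVn.
  by rewrite -xyi -{1}yV conjgE -!mulgA y2 mulg1 yV.
have yxV i : (y * x ^- i = x ^+ i * y)%g.
  by apply: (mulgI (x ^- i)%g); rewrite mulKg mulgA -yx mulgK.
have cVX i j : (x ^- i * x ^+ j = x ^+ j * x ^- i)%g.
  exact/commute_sym/commuteV/commuteX2.
congr (\det _); apply/matrixP=> i j; rewrite mxE.
case: (split_ordP i) => {}i ->; case: (split_ordP j) => {}j ->;
  rewrite ?block_mxEul ?block_mxEur ?block_mxEdl ?block_mxEdr !mxE;
  rewrite /dihedral_enum ?(unsplitK (inl _)) ?(unsplitK (inr _)) /a /b;
  rewrite expg_Zp_add // expg_Zp_opp //.
- by rewrite invMg yV mulgA.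
- by rewrite yx -mulgA yxV mulgA cVX.
- by rewrite invMg yV yx -mulgA (mulgA y) yxV -(mulgA _ y) y2 mulg1 cVX.
Qed.

(** * Fourier diagonalization *)

Lemma unity_root_neq0 (F : fieldType) (n : nat) (w : F) : w ^+ n.+1 = 1 -> w != 0.
Proof. by move=> wn; apply: contra_eq_neq wn => ->; rewrite expr0n eq_sym oner_neq0. Qed.

Lemma circulant_eigen (F : fieldType) (n : nat) (a : 'I_n.+1 -> F) (w : F)
    (i : 'I_n.+1) : w ^+ n.+1 = 1 ->
  \sum_j a (i - j) * w ^+ j = (\sum_l a l * w^-1 ^+ l) * w ^+ i.
Proof.
move=> wn; have w0 := unity_root_neq0 wn.
rewrite (reindex_inj (subrI i)) big_distrl /=; apply: eq_bigr => j _.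
rewrite subKr -mulrA; congr (_ * _).
apply: (mulfI (expf_neq0 j w0)); rewrite mulrA -exprMn divff // expr1n mul1r.
by rewrite -exprD -[LHS](expr_mod _ wn) -[LHS]/(w ^+ (j + (i - j))%R) addrC subrK.
Qed.

Definition fourier_mx (F : fieldType) (n : nat) (z : F) : 'M[F]_n.+1 :=
  Vandermonde n.+1 (\row_k z ^+ k).

Lemma fourier_mx_det_neq0 (F : fieldType) (n : nat) (z : F) :
  n.+1.-primitive_root z -> \det (fourier_mx n z) != 0.
Proof.
move=> zp; rewrite det_Vandermonde; apply/prodf_neq0=> i _; apply/prodf_neq0=> j ij.
rewrite !mxE subr_eq0 (eq_prim_root_expr zp) !modn_small //.
by rewrite eq_sym neq_ltn ij.
Qed.

Lemma circulant_fourier (F : fieldType) (n : nat) (z : F) (a : 'I_n.+1 -> F) :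
  z ^+ n.+1 = 1 ->
  circulant a *m fourier_mx n z =
    fourier_mx n z *m diag_mx (\row_k \sum_l a l * (z ^+ k)^-1 ^+ l).
Proof.
move=> zn; rewrite mul_mx_diag; apply/matrixP=> i k; rewrite !mxE mulrC.
rewrite -circulant_eigen; last by rewrite exprAC zn expr1n.
by apply: eq_bigr => j _; rewrite !mxE.
Qed.

Lemma tr_circulant_fourier (F : fieldType) (n : nat) (z : F) (a : 'I_n.+1 -> F) :
  z ^+ n.+1 = 1 ->
  (circulant a)^T *m fourier_mx n z =
    fourier_mx n z *m diag_mx (\row_k \sum_l a l * (z ^+ k) ^+ l).
Proof.
move=> zn.
have -> : (circulant a)^T = circulant (a \o -%R).
  by apply/matrixP=> i j; rewrite !mxE /= opprB.
rewrite circulant_fourier //; congr (_ *m diag_mx _); apply/rowP=> k; rewrite !mxE.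
rewrite (reindex_inj oppr_inj); apply: eq_bigr => l _ /=; rewrite opprK; congr (_ * _).
have wn : (z ^+ k) ^+ n.+1 = 1 by rewrite exprAC zn expr1n.
have w0 := expf_neq0 l (unity_root_neq0 wn).
rewrite exprVn; apply: (mulIf (expf_neq0 (- l)%R (unity_root_neq0 wn))).
rewrite mulVf; last exact/expf_neq0/(unity_root_neq0 wn).
by rewrite -exprD -[RHS](expr_mod _ wn) -[RHS]/((z ^+ k) ^+ (l + (- l))%R) subrr.
Qed.

(** The Fourier matrix diagonalizes the four blocks simultaneously, and diagonal
matrices commute. *)
Lemma det_dihedral_block (F : fieldType) (n : nat) (z : F) (a b : 'I_n.+1 -> F) :
  n.+1.-primitive_root z ->
  let ev c w : F := \sum_(l < n.+1) c l * w ^+ l in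
  \det (block_mx (circulant a) (circulant b) (circulant b)^T (circulant a)^T) =
  \prod_(k < n.+1) (ev a (z ^+ k) * ev a (z ^+ k)^-1 - ev b (z ^+ k) * ev b (z ^+ k)^-1).
Proof.
move=> zp ev; have zn := prim_expr_order zp.
pose V := fourier_mx n z; have V0 := fourier_mx_det_neq0 zp.
have detVV : \det (block_mx V 0 0 V) != 0 by rewrite det_ublock mulf_neq0.
apply: (mulIf detVV); rewrite -det_mulmx mulmx_block !mulmx0 !addr0 !add0r.
rewrite !circulant_fourier // !tr_circulant_fourier //.
set La := diag_mx _; set Lb := diag_mx _; set Lb' := diag_mx _; set La' := diag_mx _.
have -> : block_mx (V *m La) (V *m Lb) (V *m Lb') (V *m La')
        = block_mx V 0 0 V *m block_mx La Lb Lb' La'.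
  by rewrite mulmx_block !mul0mx !addr0 !add0r.
rewrite det_mulmx [LHS]mulrC; congr (_ * _).
rewrite det_block_commute; last exact: diag_mxC.
rewrite !mulmx_diag -raddfB /= det_diag; apply: eq_bigr => k _.
by rewrite !mxE /ev; congr (_ - _); rewrite mulrC.
Qed.

(** The determinant of f(R) + g(R) F in the two-dimensional representation
induced by the character of the rotation subgroup that takes R to w. *)
Definition dihedral_factor (f g : {poly algC}) (w : algC) : algC :=
  f.[w] * f.[w^-1] - g.[w] * g.[w^-1].

Lemma horner_modXn_unity (n : nat) (f : {poly int}) (w : algC) : w ^+ n.+1 = 1 ->
  (pZtoC (Pdiv.CommonRing.rmodp f ('X^(n.+1) - 1))).[w] = (pZtoC f).[w].
Proof.
move=> wn; have mon : ('X^(n.+1) - 1 : {poly int}) \is monic by apply: monicXnsubC.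
rewrite [in RHS](Pdiv.RingMonic.rdivp_eq mon f) rmorphD rmorphM rmorphB rmorph1 /=.
by rewrite map_polyXn !hornerE wn subrr mulr0 add0r.
Qed.

Lemma horner_sum_ord (n : nat) (f : {poly int}) (w : algC) : (size f <= n)%N ->
  (pZtoC f).[w] = \sum_(l < n) ZtoC f`_l * w ^+ l.
Proof.
move=> szf; rewrite (@horner_coef_wide _ n); last exact: leq_trans (size_poly _ _) szf.
by apply: eq_bigr => l _; rewrite coef_map.
Qed.

(** Only the residues of f and g modulo 'X^n - 1 matter at n-th roots of unity,
so f and g may be arbitrary polynomials. *)
Lemma dihedral_det_value (n : nat) (z : algC) (v : int) :
  (1 < n)%N -> n.-primitive_root z ->
  group_det_value 'D_(2 * n) v <->
  exists f g, ZtoC v = \prod_(k < n) dihedral_factor (pZtoC f) (pZtoC g) (z ^+ k).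
Proof.
case: n => [//|n]; rewrite ltnS => n_gt0 zp.
have [x [y [xn y2 xy surj]]] := dihedral_elements (n_gt0 : 1 < n.+1)%N.
have inj_e := dihedral_enum_inj (n_gt0 : 1 < n.+1)%N surj.
have detE phi : ZtoC (group_det phi) =
  \prod_(k < n.+1) dihedral_factor (\poly_(i < n.+1) ZtoC (phi (x ^+ i)%g))
      (\poly_(i < n.+1) ZtoC (phi (x ^+ i * y)%g)) (z ^+ k).
  rewrite (dihedral_det_block phi n_gt0 xn y2 xy inj_e) -det_map_mx map_block_mx.
  rewrite -!matrix.map_trmx.
  have mapc (a : 'I_n.+1 -> int) : map_mx intr (circulant a) = circulant (ZtoC \o a).
    by apply/matrixP=> i j; rewrite !mxE.
  rewrite !mapc (det_dihedral_block _ _ zp); apply: eq_bigr => k _.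
  by rewrite /dihedral_factor !horner_poly.
split=> [[phi ->]|[f [g fg]]].
  exists (\poly_(i < n.+1) phi (x ^+ i)%g), (\poly_(i < n.+1) phi (x ^+ i * y)%g).
  rewrite detE; apply: eq_bigr => k _; congr (dihedral_factor _ _ _);
  by apply/polyP=> i; rewrite coef_map !coef_poly; case: ifP.
have [d dK eK] : bijective (@dihedral_enum _ x y n.+1).
  by apply: inj_card_bij inj_e _; rewrite -cardsT mul2n card_dihedral ?card_ord ?addnn.
pose f' := Pdiv.CommonRing.rmodp f ('X^(n.+1) - 1).
pose g' := Pdiv.CommonRing.rmodp g ('X^(n.+1) - 1).
pose phi h := match split (d h) with inl i => f'`_i | inr i => g'`_(- i : 'I_n.+1)%R end.
exists phi; apply: (@intr_inj algC); rewrite detE fg; apply: eq_bigr => k _.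
have szmod (p : {poly int}) : (size (Pdiv.CommonRing.rmodp p ('X^(n.+1) - 1)) <= n.+1)%N.
  rewrite -ltnS -[X in (_ < X)%N](size_XnsubC (1 : int) (ltn0Sn n)).
  by rewrite Pdiv.CommonRing.ltn_rmodp monic_neq0 ?monicXnsubC.
have phif (i : 'I_n.+1) : phi (x ^+ i)%g = f'`_i.
  have -> : (x ^+ i)%g = dihedral_enum x y (lshift n.+1 i).
    by rewrite /dihedral_enum (unsplitK (inl i)).
  by rewrite /phi dK (unsplitK (inl i)).
(* x ^+ i * y = y * x ^- i is enumerated at the opposite index *)
have phig (i : 'I_n.+1) : phi (x ^+ i * y)%g = g'`_i.
  have -> : (x ^+ i * y)%g = dihedral_enum x y (rshift n.+1 (- i)%R).
    rewrite /dihedral_enum (unsplitK (inr _)) expg_Zp_opp // -expgVn -xy -conjXg conjgE.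
    by rewrite mulKVg.
  by rewrite /phi dK (unsplitK (inr _)) opprK.
have wn : (z ^+ k) ^+ n.+1 = 1 by rewrite exprAC (prim_expr_order zp) expr1n.
have wVn : (z ^+ k)^-1 ^+ n.+1 = 1 by rewrite exprVn wn invr1.
rewrite /dihedral_factor -(horner_modXn_unity f wn) -(horner_modXn_unity g wn).
rewrite -(horner_modXn_unity f wVn) -(horner_modXn_unity g wVn).
rewrite !(horner_sum_ord _ (szmod _)) !horner_poly.
by congr (_ * _ - _ * _); apply: eq_bigr => i _; rewrite ?phif ?phig.
Qed.

(** * Products over roots of unity of order a power of 2 *)

(** A Graeffe root-squaring step: with h = e(X^2) + X o(X^2), the polynomial
e^2 - X o^2 takes the value h(c) h(-c) at c^2.  The translation by 2 is chosen
because c = w + w^-1 gives c^2 - 2 = w^2 + w^-2, so that the step can be iterated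
along w, w^2, w^4 and so on. *)
Definition graeffe (h : {poly int}) : {poly int} :=
  (even_poly h * even_poly h - 'X * (odd_poly h * odd_poly h)) \Po ('X + 2%:P).

Lemma horner_map_even_odd (R : comNzRingType) (h : {poly int}) (x : R) :
  (map_poly intr h).[x] = (map_poly intr (even_poly h)).[x ^+ 2]
                        + (map_poly intr (odd_poly h)).[x ^+ 2] * x.
Proof.
rewrite -[in LHS](poly_even_odd h) rmorphD rmorphM /= !map_comp_poly.
by rewrite map_polyXn map_polyX hornerD hornerMX !horner_comp hornerXn.
Qed.

Lemma horner_graeffe (R : comNzRingType) (h : {poly int}) (c : R) :
  (map_poly intr (graeffe h)).[c ^+ 2 - 2] =
    (map_poly intr h).[c] * (map_poly intr h).[- c].
Proof.
pose e := map_poly intr (even_poly h) : {poly R}.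
pose o := map_poly intr (odd_poly h) : {poly R}.
rewrite (horner_map_even_odd h c) (horner_map_even_odd h (- c)).
rewrite sqrrN -/e -/o /graeffe map_comp_poly horner_comp.
rewrite [in X in _.[X]]rmorphD /= map_polyX map_polyC hornerD hornerX hornerC subrK.
rewrite rmorphB !rmorphM /= map_polyX -/e -/o.
rewrite hornerD hornerN !hornerM hornerX; ring.
Qed.

Lemma prod_fold (R : comPzRingType) (m : nat) (F : nat -> R) :
  \prod_(0 <= i < m + m) F i = \prod_(0 <= i < m) (F i * F (m + m - i.+1)%N).
Proof.
rewrite !big_mkord big_split big_split_ord /=; congr (_ * _).
rewrite (reindex_inj rev_ord_inj) /=; apply: eq_bigr => i _.
by rewrite addnBA.
Qed.

Lemma prod_even_odd (R : comPzRingType) (m : nat) (F : nat -> R) :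
  \prod_(1 <= i < m.+1.*2) F i =
    \prod_(1 <= i < m.+1) F i.*2 * \prod_(0 <= i < m.+1) F i.*2.+1.
Proof.
elim: m => [|m IHm]; first by rewrite !big_nat1 big_geq // mul1r.
rewrite doubleS 2?big_nat_recr //= IHm [\prod_(1 <= i < m.+2) _]big_nat_recr //=.
rewrite [\prod_(0 <= i < m.+2) _]big_nat_recr //=; ring.
Qed.

(** The points w + w^-1, for w an odd power of z up to inversion, are stable
under negation.  Pairing opposite points turns the product for h and z into the
product for graeffe h and z ^+ 2 over half as many points; after s steps the
only point left is 'i + 'i^-1 = 0. *)
Lemma prod_odd_powers (s : nat) (h : {poly int}) (z : algC) : z ^+ (2 ^ s.+1) = -1 ->
  \prod_(0 <= i < 2 ^ s) (pZtoC h).[z ^+ i.*2.+1 + (z ^+ i.*2.+1)^-1]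
    = ZtoC (iter s graeffe h).[0].
Proof.
have z0 (w : algC) m : w ^+ m.+1 = -1 -> w != 0.
  by apply: contra_eq_neq => ->; rewrite expr0n eq_sym oppr_eq0 oner_neq0.
elim: s h z => [|s IHs] h z zs.
  rewrite big_nat1 expr1; have zn0 := z0 _ _ zs.
  have -> : z + z^-1 = 0.
    by apply: (mulfI zn0); rewrite mulrDr mulfV // -expr2 zs addNr mulr0.
  by rewrite -[0 in LHS](rmorph0 ZtoC) horner_map.
have zn0 : z != 0 by apply: (z0 _ (2 ^ s.+2).-1); rewrite prednK ?expn_gt0.
rewrite expnS mul2n -addnn prod_fold iterSr.
rewrite -(IHs _ (z ^+ 2)); last by rewrite -exprM -expnS.
apply: eq_big_nat => i /andP[_ lti].
set w := z ^+ i.*2.+1; have wn0 : w != 0 by rewrite expf_neq0.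
have -> : z ^+ (2 ^ s + 2 ^ s - i.+1).*2.+1 = - w^-1.
  apply: (mulfI wn0); rewrite mulrN mulfV // -exprD -zs; congr (z ^+ _).
  by rewrite !expnS; move: (2 ^ s)%N lti => m lti; lia.
have -> : (z ^+ 2) ^+ i.*2.+1 = w ^+ 2 by rewrite exprAC.
have -> : w ^+ 2 + (w ^+ 2)^-1 = (w + w^-1) ^+ 2 - 2.
  by rewrite sqrrD mulfV // exprVn; ring.
by rewrite horner_graeffe invrN invrK opprD [- w + _]addrC.
Qed.

(** Even powers of z are the powers of z ^+ 2, which gives an induction.  The odd
powers are stable under inversion, which preserves w + w^-1, so that they
contribute a square. *)
Lemma prod_nontrivial_powers (s : nat) (h : {poly int}) (z : algC) : z ^+ (2 ^ s) = -1 ->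
  \prod_(1 <= i < 2 ^ s.+1) (pZtoC h).[z ^+ i + (z ^+ i)^-1]
    = ZtoC (h.[-2] * \prod_(0 <= j < s) (iter j graeffe h).[0] ^+ 2).
Proof.
elim: s z => [|s IHs] z zs.
  rewrite big_nat1 big_geq // mulr1 !expr1 [z]zs invrN invr1 -opprD.
  by rewrite -[_ + 1](rmorphD ZtoC 1 1) -[- _](rmorphN ZtoC) horner_map.
have [m Dm] : exists m, (2 ^ s.+1 = m.+1)%N by exists (2 ^ s.+1).-1; rewrite prednK ?expn_gt0.
rewrite expnS mul2n Dm prod_even_odd -Dm.
have -> : \prod_(1 <= i < 2 ^ s.+1) (pZtoC h).[z ^+ i.*2 + (z ^+ i.*2)^-1]
   = \prod_(1 <= i < 2 ^ s.+1) (pZtoC h).[(z ^+ 2) ^+ i + ((z ^+ 2) ^+ i)^-1].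
  by apply: eq_bigr => i _; rewrite -mul2n exprM.
rewrite IHs -?exprM -?expnS // big_nat_recr //= mulrA [RHS]rmorphM /=; congr (_ * _).
rewrite rmorphXn /= -(prod_odd_powers h zs) expr2 [in LHS]expnS mul2n -addnn.
rewrite prod_fold -big_split /=; apply: eq_big_nat => i /andP[_ lti].
congr (_ * _).
have wn0 : z ^+ i.*2.+1 != 0.
  apply: contra_eq_neq zs => z0; have /eqP := z0; rewrite expf_eq0 => /andP[_ /eqP->].
  by rewrite expr0n expn_eq0 /= eq_sym oppr_eq0 oner_neq0.
have -> : z ^+ (2 ^ s + 2 ^ s - i.+1).*2.+1 = (z ^+ i.*2.+1)^-1.
  apply: (mulfI wn0); rewrite mulfV // -exprD.
  have -> : (i.*2.+1 + (2 ^ s + 2 ^ s - i.+1).*2.+1 = 2 ^ s.+1 * 2)%N.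
    by rewrite expnS; move: (2 ^ s)%N lti => m' lti; lia.
  by rewrite exprM zs sqrrN expr1n.
by rewrite invrK addrC.
Qed.

(** * The determinant of the Klein four-group *)

Lemma int_parity (x : int) : exists y : int, x = 2 * y \/ x = 2 * y + 1.
Proof. by exists (x %/ 2)%Z; lia. Qed.

(** The group determinant of the Klein four-group, factored along its characters;
it is also the contribution of w = 1 and w = -1 to a dihedral determinant. *)
Definition klein_product (a b c d : int) : int :=
  (a + b + c + d) * (a + b - c - d) * (a - b + c - d) * (a - b - c + d).

Lemma prod4_even_sum (p q r s : int) : (2 %| p + q + r + s)%Z ->
  (4 %| p * q * r * s)%Z \/ [/\ ~~ (2 %| p)%Z, ~~ (2 %| q)%Z, ~~ (2 %| r)%Z & ~~ (2 %| s)%Z].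
Proof.
move=> even_sum.
have pair (x y t : int) : (2 %| x)%Z -> (2 %| y)%Z -> (4 %| x * y * t)%Z.
  by move=> x2 y2; apply/dvdz_mulr/(dvdz_mul x2 y2).
have [p2|p2] := boolP (2 %| p)%Z; have [q2|q2] := boolP (2 %| q)%Z.
- by left; rewrite -mulrA pair.
- have [r2|r2] := boolP (2 %| r)%Z.
    by left; rewrite [X in (_ %| X)%Z](_ : _ = p * r * (q * s)) ?pair //; ring.
  have [s2|s2] := boolP (2 %| s)%Z; last by lia.
  by left; rewrite [X in (_ %| X)%Z](_ : _ = p * s * (q * r)) ?pair //; ring.
- have [r2|r2] := boolP (2 %| r)%Z.
    by left; rewrite [X in (_ %| X)%Z](_ : _ = q * r * (p * s)) ?pair //; ring.
  have [s2|s2] := boolP (2 %| s)%Z; last by lia.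
  by left; rewrite [X in (_ %| X)%Z](_ : _ = q * s * (p * r)) ?pair //; ring.
- have [r2|r2] := boolP (2 %| r)%Z; last by right; split=> //; lia.
  have [s2|s2] := boolP (2 %| s)%Z; last by lia.
  by left; rewrite [X in (_ %| X)%Z](_ : _ = r * s * (p * q)) ?pair //; ring.
Qed.

(** The factors are u + w and u - w for (u, w) = (a + b, c + d) and for
(u, w) = (a - b, c - d).  Both u^2 - w^2 are odd and the two u have the same
parity, so that both are 1 or both are -1 modulo 4. *)
Lemma klein_product_odd (a b c d : int) : ~~ (2 %| a + b + c + d)%Z ->
  exists m, klein_product a b c d = 4 * m + 1.
Proof.
move=> odd_sum; have [x Dx] := int_parity (a + b); have [y Dy] := int_parity (c + d).
pose P (u w b d : int) :=
  (u + w) * (u - w) * ((u - 2 * b + (w - 2 * d)) * (u - 2 * b - (w - 2 * d))).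
have -> : klein_product a b c d = P (a + b) (c + d) b d by rewrite /klein_product /P; ring.
case: Dx => Dx; case: Dy => Dy; rewrite Dx Dy; try lia.
  pose X := x ^+ 2 - y ^+ 2 - y; pose Y := (x - b) ^+ 2 - (y - d) ^+ 2 - (y - d).
  by exists (4 * X * Y - X - Y); rewrite /P /X /Y; ring.
pose X := x ^+ 2 + x - y ^+ 2; pose Y := (x - b) ^+ 2 + (x - b) - (y - d) ^+ 2.
by exists (4 * X * Y + X + Y); rewrite /P /X /Y; ring.
Qed.

(** Each linear form is twice an integer, and these four integers have an even sum:
either two of them are even, or all are odd, which forces the four arguments to
be congruent modulo 2. *)
Lemma klein_product_even (a b c d : int) : (2 %| a + b + c + d)%Z ->
  (exists m, klein_product a b c d = 2 ^+ 6 * m) \/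
  (exists m, klein_product a b c d = 2 ^+ 4 * (2 * m + 1)) /\
    [/\ (2 %| a - b)%Z, (2 %| a - c)%Z & (2 %| a - d)%Z].
Proof.
move=> /dvdzP[l Dl].
have Db : b = 2 * l - a - c - d by lia.
have -> : klein_product a b c d = 2 ^+ 4 * (l * (l - c - d) * (a + c - l) * (a + d - l)).
  by rewrite /klein_product Db; ring.
have sum_even : (2 %| l + (l - c - d) + (a + c - l) + (a + d - l))%Z by lia.
have [/dvdzP[m ->]|[odd1 odd2 odd3 odd4]] := prod4_even_sum sum_even.
  by left; exists m; ring.
right; split; last by split; lia.
set Q := l * _ * _ * _; have : ~~ (2 %| Q)%Z.
  rewrite /Q !dvdzE !abszM !Euclid_dvdM //; rewrite !dvdzE in odd1 odd2 odd3 odd4.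
  by rewrite !negb_or odd1 odd2 odd3 odd4.
have [m [->|->]] := int_parity Q; first by lia.
by exists m.
Qed.

Lemma circulant_comm (R : comNzRingType) (n : nat) (a b : 'I_n.+1 -> R) :
  circulant a *m circulant b = circulant b *m circulant a.
Proof.
apply/matrixP=> i j; rewrite !mxE (reindex_inj (subrI (i + j))) /=.
apply: eq_bigr => k _; rewrite !mxE mulrC; congr (b _ * a _).
  by rewrite addrAC addrK.
by rewrite opprB addrA (addrC i k) opprD addrA addrK.
Qed.

Lemma det_circulant2 (a : 'I_2 -> int) :
  \det (circulant a) = (a 0 + a 1) * (a 0 - a 1).
Proof.
rewrite (expand_det_row _ 0) !big_ord_recl big_ord0 /cofactor !det_mx11 !mxE.
transitivity (a 0 * ((-1) ^+ 0 * a 0) + (a 1 * ((-1) ^+ 1 * a 1) + 0)); last by ring.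
by congr (a _ * (_ * a _) + (a _ * (_ * a _) + 0)); apply/eqP.
Qed.

Lemma klein_four_det (x : klein_four -> int) :
  group_det x = klein_product (x (0, 0)) (x (1, 0)) (x (0, 1)) (x (1, 1)).
Proof.
pose e (i : 'I_(2 + 2)) : klein_four :=
  match split i with inl i => (i, 0) | inr i => (i, 1) end.
have inj_e : injective e.
  move=> i j; rewrite /e; case: (split_ordP i) => {}i ->; case: (split_ordP j) => {}j ->;
  by rewrite ?(unsplitK (inl _)) ?(unsplitK (inr _)) => /eqP;
     rewrite xpair_eqE => /andP[/eqP->].
rewrite (group_det_reindex x inj_e); last by rewrite card_prod !card_ord.
have divE (p q : klein_four) : (p * q^-1)%g = (p.1 - q.1, p.2 - q.2) by [].
have sub01 : 0 - 1 = 1 :> 'Z_2 by apply/eqP.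
pose a (i : 'I_2) := x (i, 0); pose b (i : 'I_2) := x (i, 1).
transitivity (\det (block_mx (circulant a) (circulant b) (circulant b) (circulant a))).
  congr (\det _); apply/matrixP=> i j; rewrite mxE.
  case: (split_ordP i) => {}i ->; case: (split_ordP j) => {}j ->;
  rewrite ?block_mxEul ?block_mxEur ?block_mxEdl ?block_mxEdr !mxE /e;
  by rewrite ?(unsplitK (inl _)) ?(unsplitK (inr _)) divE /= ?subrr ?subr0 ?sub01.
rewrite det_block_commute; last exact: circulant_comm.
have -> : circulant a *m circulant a - circulant b *m circulant b =
  circulant (fun i => a i - b i) *m circulant (fun i => a i + b i).
  have -> : circulant (fun i => a i - b i) = circulant a - circulant b.
    by apply/matrixP=> i j; rewrite !mxE.
  have -> : circulant (fun i => a i + b i) = circulant a + circulant b.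
    by apply/matrixP=> i j; rewrite !mxE.
  by rewrite mulmxDr !mulmxBl (circulant_comm a b) addrA subrK.
by rewrite det_mulmx !det_circulant2 /klein_product /a /b; ring.
Qed.

(** * Polynomials in the trace w + 1/w *)

Section HornerZtoC.
Variables (p q : {poly int}) (x : algC) (c : int).
Lemma hornerZD : (pZtoC (p + q)).[x] = (pZtoC p).[x] + (pZtoC q).[x].
Proof. by rewrite rmorphD hornerD. Qed.
Lemma hornerZN : (pZtoC (- p)).[x] = - (pZtoC p).[x].
Proof. by rewrite rmorphN hornerN. Qed.
Lemma hornerZM : (pZtoC (p * q)).[x] = (pZtoC p).[x] * (pZtoC q).[x].
Proof. by rewrite rmorphM hornerM. Qed.
Lemma hornerZC : (pZtoC c%:P).[x] = ZtoC c.
Proof. by rewrite map_polyC hornerC. Qed.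
Lemma hornerZX : (pZtoC 'X).[x] = x.
Proof. by rewrite map_polyX hornerX. Qed.
End HornerZtoC.

Definition hornerZE := (hornerZD, hornerZN, hornerZM, hornerZC, hornerZX).

(** Each of the three symmetric expressions in w and w^-1 for p * 'X + c%:P is a
polynomial in those for p and in w + w^-1, so that the three are carried through
the induction together. *)
Lemma horner_trace (f : {poly int}) : exists h1 h2 h3 : {poly int},
  forall w : algC, w != 0 ->
  [/\ (pZtoC f).[w] + (pZtoC f).[w^-1] = (pZtoC h1).[w + w^-1],
      w * (pZtoC f).[w] + w^-1 * (pZtoC f).[w^-1] = (pZtoC h2).[w + w^-1]
    & (pZtoC f).[w] * (pZtoC f).[w^-1] = (pZtoC h3).[w + w^-1]].
Proof.
elim/poly_ind: f => [|p c [h1 [h2 [h3 IHp]]]].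
  exists 0, 0, 0 => w _; rewrite rmorph0 !horner0 !mulr0 addr0; by split.
exists (h2 + (c + c)%:P), ('X * h2 - h1 + c%:P * 'X), (h3 + c%:P * h2 + (c * c)%:P) => w w0.
have [E1 E2 E3] := IHp w w0; rewrite !hornerZE -E1 -E2 -E3.
by split; field.
Qed.

Lemma dihedral_factor_trace (f g : {poly int}) : exists h : {poly int},
  forall w : algC, w != 0 ->
  dihedral_factor (pZtoC f) (pZtoC g) w = (pZtoC h).[w + w^-1].
Proof.
have [? [? [hf fP]]] := horner_trace f; have [? [? [hg gP]]] := horner_trace g.
exists (hf - hg) => w w0; rewrite /dihedral_factor.
have [_ _ fE] := fP w w0; have [_ _ gE] := gP w w0; rewrite fE gE.
by rewrite rmorphB /= hornerD hornerN.
Qed.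

Lemma horner_even_odd (R : comNzRingType) (p : {poly R}) (x : R) :
  p.[x] = (even_poly p).[x ^+ 2] + (odd_poly p).[x ^+ 2] * x.
Proof. by rewrite -[in LHS](poly_even_odd p) hornerD hornerMX !horner_comp hornerXn. Qed.

Lemma dvdz_horner_sub (p : {poly int}) (x y : int) : (x - y %| p.[x] - p.[y])%Z.
Proof.
elim/poly_ind: p => [|p c IHp]; first by rewrite !horner0 subrr dvdz0.
rewrite !hornerMXaddC.
have -> : p.[x] * x + c - (p.[y] * y + c) = (p.[x] - p.[y]) * x + p.[y] * (x - y) by ring.
by apply: rpredD; [exact: dvdz_mulr | exact: dvdz_mull (dvdzz _)].
Qed.

Lemma dvdz2_horner_sub (p : {poly int}) (x y : int) :
  (2 %| x - y)%Z -> (2 %| p.[x] - p.[y])%Z.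
Proof. by move=> /dvdz_trans; apply; apply: dvdz_horner_sub. Qed.

Lemma dvdz2_sqr_sub (t : int) : (2 %| t ^+ 2 - t)%Z.
Proof.
have [y [->|->]] := int_parity t; apply/dvdzP;
by [exists (2 * y ^+ 2 - y); ring | exists (2 * y ^+ 2 + y); ring].
Qed.

(** Modulo 2 the translation by 2 disappears and squaring does nothing to values,
so that e(x)^2 - x o(x)^2 is e(x^2) + x o(x^2) = h(x). *)
Lemma graeffe_mod2 (h : {poly int}) (x : int) : (2 %| (graeffe h).[x] - h.[x])%Z.
Proof.
have x2 : (2 %| x + 2 - x ^+ 2)%Z by have := dvdz2_sqr_sub x; lia.
rewrite (horner_even_odd h) /graeffe horner_comp hornerD.
rewrite [('X + _).[_]]hornerD hornerX hornerC hornerN.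
rewrite !hornerM hornerX.
have := dvdz2_horner_sub (even_poly h) x2; have := dvdz2_horner_sub (odd_poly h) x2.
set e := (even_poly h).[x + 2]; set o := (odd_poly h).[x + 2].
set e' := (even_poly h).[_]; set o' := (odd_poly h).[_].
move=> /dvdzP[r Dr] /dvdzP[q Dq].
have /dvdzP[t Dt] := dvdz2_sqr_sub e; have /dvdzP[u Du] := dvdz2_sqr_sub o.
apply/dvdzP; exists (t - x * u - o ^+ 2 + q + r * x - o * x).
have -> : e' = e - q * 2 by rewrite -Dq; ring.
have -> : o' = o - r * 2 by rewrite -Dr; ring.
apply/subr0_eq; transitivity ((e ^+ 2 - e - t * 2) - x * (o ^+ 2 - o - u * 2)); first ring.
by rewrite Dt Du; ring.
Qed.

Lemma iter_graeffe_mod2 (j : nat) (h : {poly int}) (x : int) :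
  (2 %| (iter j graeffe h).[x] - h.[x])%Z.
Proof.
elim: j => [|j IHj]; first by rewrite subrr dvdz0.
by have := graeffe_mod2 (iter j graeffe h) x; rewrite iterS; lia.
Qed.

(** * Necessary conditions *)

Lemma prim_root_half (s : nat) (z : algC) :
  (2 ^ s.+1).-primitive_root z -> z ^+ (2 ^ s) = -1.
Proof.
move=> zp; have /eqP := prim_expr_order zp; rewrite expnSr exprM sqrf_eq1.
by rewrite -(prim_order_dvd zp) dvdn_Pexp2l // ltnn /= => /eqP.
Qed.

Lemma prod_ord_recl_nat (n : nat) (F : nat -> algC) : (0 < n)%N ->
  \prod_(k < n) F k = F 0 * \prod_(1 <= k < n) F k.
Proof. by move=> n0; rewrite -(big_mkord xpredT F) big_ltn. Qed.

Lemma hornerZ_int (p : {poly int}) (x : int) : (pZtoC p).[ZtoC x] = ZtoC p.[x].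
Proof. exact: horner_map. Qed.

Lemma even_odd_poly_mod2 (p : {poly int}) :
  (2 %| (even_poly p).[1] - (even_poly p).[-1])%Z /\
  (2 %| (odd_poly p).[1] - (odd_poly p).[-1])%Z.
Proof. by split; apply: dvdz2_horner_sub. Qed.

Lemma horner_norm_i (p : {poly int}) :
  (pZtoC p).['i] * (pZtoC p).['i^-1] =
    ZtoC ((even_poly p).[-1] ^+ 2 + (odd_poly p).[-1] ^+ 2).
Proof.
have hE x : x ^+ 2 = -1 ->
    (pZtoC p).[x] = ZtoC (even_poly p).[-1] + ZtoC (odd_poly p).[-1] * x.
  by move=> x2; rewrite -!hornerZ_int (horner_map_even_odd p) x2 rmorphN rmorph1.
have iV : 'i^-1 = - 'i :> algC by rewrite invCi.
rewrite !hE ?iV ?sqrrN ?sqrCi // [RHS]rmorphD !rmorphXn /=.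
set e := ZtoC _; set o := ZtoC _; transitivity (e ^+ 2 - o ^+ 2 * 'i ^+ 2); first ring.
by rewrite sqrCi; ring.
Qed.

Lemma sqr_sub_sqr_mod2 (u w x y : int) :
  (2 %| u ^+ 2 - w ^+ 2 - x)%Z -> (2 %| y - x)%Z -> (2 %| y - (u + w))%Z.
Proof.
have := dvdz2_sqr_sub u; have := dvdz2_sqr_sub w.
by move: (u ^+ 2) (w ^+ 2) => u2 w2; lia.
Qed.

(** Here a, b and c, d are the sums of the coefficients of f and g over even and
odd exponents, and a', b', c', d' are the corresponding alternating sums, which
are the real and imaginary parts of f and g at 'i. *)
Lemma dihedral_value_decomp (s : nat) (v : int) : group_det_value 'D_(2 ^ s.+3) v ->
  exists (a b c d a' b' c' d' : int) (C : nat -> int),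
  [/\ v = klein_product a b c d * \prod_(0 <= j < s.+1) C j ^+ 2,
      forall j, (2 %| C j - (a + b + c + d))%Z,
      [/\ (2 %| a - a')%Z, (2 %| b - b')%Z, (2 %| c - c')%Z & (2 %| d - d')%Z]
    & C 0 = a' ^+ 2 + b' ^+ 2 - c' ^+ 2 - d' ^+ 2].
Proof.
have n_gt1 : (1 < 2 ^ s.+2)%N by rewrite (ltn_exp2l 0).
have [z zp] := C_prim_root_exists (ltnW n_gt1).
rewrite expnS => /(dihedral_det_value v n_gt1 zp)[f [g Dv]].
have [h hP] := dihedral_factor_trace f g.
have z0 k : z ^+ k != 0.
  by rewrite expf_neq0 // (@unity_root_neq0 _ (2 ^ s.+2).-1) // prednK ?expn_gt0 // prim_expr_order.
have dihedral_factor_pm1 x (e : int) : (x == e%:~R) && (x == x^-1) ->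
    dihedral_factor (pZtoC f) (pZtoC g) x = ZtoC (f.[e] ^+ 2 - g.[e] ^+ 2).
  move=> /andP[/eqP xe /eqP xV]; rewrite /dihedral_factor -xV xe !hornerZ_int.
  by rewrite !expr2 rmorphB !rmorphM.
have h2 : h.[2] = f.[1] ^+ 2 - g.[1] ^+ 2.
  apply: (@intr_inj algC); have := hP 1 (oner_neq0 _).
  rewrite (dihedral_factor_pm1 1 1) ?invr1 ?eqxx // => ->.
  exact/esym/(hornerZ_int h 2).
have hN2 : h.[-2] = f.[-1] ^+ 2 - g.[-1] ^+ 2.
  apply: (@intr_inj algC); have := hP (-1); rewrite oppr_eq0 oner_neq0 => /(_ isT).
  rewrite (dihedral_factor_pm1 (-1) (-1)) ?invrN ?invr1 ?rmorphN ?eqxx // => ->.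
  by rewrite -opprD; apply/esym/(hornerZ_int h (-2)).
have h0 : h.[0] = (even_poly f).[-1] ^+ 2 + (odd_poly f).[-1] ^+ 2
                - (even_poly g).[-1] ^+ 2 - (odd_poly g).[-1] ^+ 2.
  apply: (@intr_inj algC); rewrite -hornerZ_int.
  have iV : 'i + 'i^-1 = 0 :> algC by rewrite invCi subrr.
  have := hP 'i (neq0Ci _); rewrite iV /dihedral_factor !horner_norm_i => <-.
  by rewrite -rmorphB opprD addrA.
exists (even_poly f).[1], (odd_poly f).[1], (even_poly g).[1], (odd_poly g).[1].
exists (even_poly f).[-1], (odd_poly f).[-1], (even_poly g).[-1], (odd_poly g).[-1].
exists (fun j => (iter j graeffe h).[0]).
have [fe fo] := even_odd_poly_mod2 f; have [ge go] := even_odd_poly_mod2 g.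
split=> //.
- apply: (@intr_inj algC); rewrite Dv.
  rewrite (prod_ord_recl_nat (fun k => dihedral_factor _ _ (z ^+ k))) ?(ltnW n_gt1) //.
  under eq_bigr => k _ do rewrite hP //.
  rewrite hP // invr1 (hornerZ_int h 2).
  rewrite (prod_nontrivial_powers _ (prim_root_half zp)) -rmorphM mulrA.
  congr (ZtoC (_ * _)); rewrite h2 hN2 /klein_product.
  rewrite (horner_even_odd f 1) (horner_even_odd g 1).
  rewrite (horner_even_odd f (-1)) (horner_even_odd g (-1)).
  by rewrite sqrrN expr1n; ring.
- move=> j; rewrite -[in X in _ - X]addrA.
  apply: sqr_sub_sqr_mod2 (iter_graeffe_mod2 j h 0).
  have := @dvdz2_horner_sub h 2 0 isT.
  by rewrite h2 (horner_even_odd f 1) (horner_even_odd g 1) expr1n !mulr1.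
Qed.

Lemma prod_sqr_even (n : nat) (C : nat -> int) :
  (forall j, 2 %| C j)%Z -> (2 ^+ (2 * n) %| \prod_(0 <= j < n) C j ^+ 2)%Z.
Proof.
move=> evC; elim: n => [|n IHn]; first by rewrite big_geq.
rewrite big_nat_recr //= mulnS addnC exprD; apply: dvdz_mul => //.
exact: dvdz_exp2r.
Qed.

Lemma prod_sqr_odd (n : nat) (C : nat -> int) : (forall j, ~~ (2 %| C j)%Z) ->
  exists m, \prod_(0 <= j < n) C j ^+ 2 = 4 * m + 1.
Proof.
move=> oddC; elim: n => [|n [m IHn]]; first by exists 0; rewrite big_geq.
rewrite big_nat_recr //= IHn.
have [y [Dy|->]] := int_parity (C n); first by have := oddC n; lia.
by exists (m * (4 * (y ^+ 2 + y) + 1) + y ^+ 2 + y); ring.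
Qed.

(** Squares modulo 4 depend only on parity, and all the arguments have the same
parity. *)
Lemma diff_sqr_mod4 (a b c d a' b' c' d' : int) :
  (2 %| a - b)%Z -> (2 %| a - c)%Z -> (2 %| a - d)%Z ->
  (2 %| a - a')%Z -> (2 %| b - b')%Z -> (2 %| c - c')%Z -> (2 %| d - d')%Z ->
  (4 %| a' ^+ 2 + b' ^+ 2 - c' ^+ 2 - d' ^+ 2)%Z.
Proof.
move=> ab ac ad aa bb cc dd.
have /dvdzP[b1 Db] : (2 %| b' - a')%Z by lia.
have /dvdzP[c1 Dc] : (2 %| c' - a')%Z by lia.
have /dvdzP[d1 Dd] : (2 %| d' - a')%Z by lia.
rewrite -[b'](subrK a') -[c'](subrK a') -[d'](subrK a') Db Dc Dd.
apply/dvdzP; exists (b1 ^+ 2 + b1 * a' - c1 ^+ 2 - c1 * a' - d1 ^+ 2 - d1 * a'); ring.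
Qed.

(** In the even case, when 2^6 does not divide the Klein factor, the two missing
powers of 2 come from C_0, which is then divisible by 4 and not just by 2. *)
Lemma dihedral_value_necessary (s : nat) (v : int) : group_det_value 'D_(2 ^ s.+3) v ->
  (exists m, v = 4 * m + 1) \/ exists m, v = 2 ^+ (2 * s + 8) * m.
Proof.
move=> /dihedral_value_decomp[a [b [c [d [a' [b' [c' [d' [C]]]]]]]]].
move=> [-> parC [aa bb cc dd] C0].
have [ev|od] := boolP (2 %| a + b + c + d)%Z; last first.
  left; have [m ->] := klein_product_odd od.
  have [j|m' ->] := @prod_sqr_odd s.+1 C.
    by apply: contra od => Cj; have := parC j; clear -Cj; lia.
  by exists (4 * m * m' + m + m'); ring.
have evC j : (2 %| C j)%Z by have := parC j; clear -ev; lia.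
right; suff /dvdzP[m ->] : (2 ^+ (2 * s + 8) %|
     klein_product a b c d * \prod_(0 <= j < s.+1) C j ^+ 2)%Z.
  by exists m; rewrite mulrC.
have [[m ->]|[[m ->] [ab ac ad]]] := klein_product_even ev.
  have -> : (2 * s + 8 = 6 + 2 * s.+1)%N by lia.
  rewrite exprD; apply: dvdz_mul; [exact: dvdz_mulr | exact: prod_sqr_even].
have -> : (2 * s + 8 = 4 + (4 + 2 * s))%N by lia.
rewrite exprD; apply: dvdz_mul; first exact: dvdz_mulr.
rewrite big_nat_recl // exprD; apply: dvdz_mul; last exact: (@prod_sqr_even s (fun j => C j.+1)).
rewrite -[4%N in X in (X %| _)%Z]/(2 * 2)%N exprM; apply: dvdz_exp2r.
by rewrite C0; apply: (diff_sqr_mod4 ab ac ad).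
Qed.

(** * Constructing values *)

Definition hornerPE := (hornerD, hornerN, hornerM, hornerC, hornerX).

Definition geom_poly (R : nzRingType) (n : nat) : {poly R} := \sum_(i < n) 'X^i.

Lemma horner_geom_poly (n : nat) (w : algC) :
  (pZtoC (geom_poly _ n)).[w] = \sum_(i < n) w ^+ i.
Proof.
rewrite rmorph_sum horner_sum; apply: eq_bigr => i _.
by rewrite /= map_polyXn hornerXn.
Qed.

Lemma horner_geom_poly1 (n : nat) : (geom_poly int n).[1] = n%:R.
Proof.
rewrite horner_sum; under eq_bigr => i _ do rewrite hornerXn expr1n.
by rewrite sumr_const card_ord.
Qed.

Lemma geom_sumE (n : nat) (w : algC) : w != 1 ->
  \sum_(i < n) w ^+ i = (w ^+ n - 1) / (w - 1).
Proof. by move=> w1; rewrite subrX1 mulrC mulKf // subr_eq0. Qed.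

Section PrimitiveRoot.
Variables (n : nat) (z : algC).
Hypothesis zp : n.-primitive_root z.

Lemma prim_pow_neq0 k : z ^+ k != 0.
Proof.
apply: expf_neq0; apply: contra_eq_neq (prim_expr_order zp) => ->.
by rewrite expr0n eqn0Ngt (prim_order_gt0 zp) eq_sym oner_neq0.
Qed.

Lemma prim_pow_neq1 k : (1 <= k < n)%N -> z ^+ k != 1.
Proof.
move=> /andP[k1 kn]; rewrite -(prim_order_dvd zp).
by apply: contraL kn => dvd_nk; rewrite -leqNgt dvdn_leq.
Qed.

Lemma prim_pow_order k : (z ^+ k) ^+ n = 1.
Proof. by rewrite exprAC (prim_expr_order zp) expr1n. Qed.

(** The value at 1 of ('X^n - 1) / ('X - 1). *)
Lemma prod_one_sub_prim_pow : \prod_(1 <= k < n) (1 - z ^+ k) = n%:R.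
Proof.
have X1 : 'X - 1 != 0 :> {poly algC} by rewrite monic_neq0 ?(monicXsubC 1).
have E : \prod_(1 <= k < n) ('X - (z ^+ k)%:P) = \sum_(i < n) 'X^i.
  by apply: (mulfI X1); rewrite -subrX1 -(factor_Xn_sub_1 zp) [RHS]big_ltn ?(prim_order_gt0 zp).
have /(congr1 (horner_eval 1)) := E; rewrite /horner_eval horner_prod horner_sum.
under eq_bigr => i _ do rewrite hornerXsubC.
move=> ->; under eq_bigr => i _ do rewrite hornerXn expr1n.
by rewrite sumr_const card_ord.
Qed.

(** The inverse of z ^+ k is z ^+ (n - k), so that the product of all the powers is
its own inverse. *)
Lemma prod_prim_pow_sqr : \prod_(1 <= k < n) (z ^+ k) ^+ 2 = 1.
Proof.
under eq_bigr => k _ do rewrite expr2.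
rewrite big_split /= [X in _ * X]big_nat_rev /= -big_split /=.
rewrite big_nat big1 // => k /andP[k1 kn]; rewrite -exprD.
have -> : (k + (1 + n - k.+1) = n)%N by lia.
exact: prim_expr_order.
Qed.

End PrimitiveRoot.

(** The polynomial 1 + 'X + ... + 'X^(n-1) vanishes at the n-th roots of unity other
than 1, and its value at 1 is n. *)
Lemma dihedral_value_shift (n : nat) (z : algC) (f g : {poly int}) (P t : int) :
  (1 < n)%N -> n.-primitive_root z ->
  \prod_(1 <= k < n) dihedral_factor (pZtoC f) (pZtoC g) (z ^+ k) = ZtoC P ->
  group_det_value 'D_(2 * n) ((f.[1] - g.[1]) * (f.[1] + g.[1] + (2 * n)%:R * t) * P).
Proof.
move=> n_gt1 zp DP; have n_gt0 := ltnW n_gt1.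
apply/(dihedral_det_value _ n_gt1 zp).
pose f' := f + t%:P * geom_poly _ n; pose g' := g + t%:P * geom_poly _ n.
exists f', g'.
rewrite (prod_ord_recl_nat (fun k => dihedral_factor _ _ (z ^+ k))) // rmorphM /= -DP.
congr (_ * _).
  rewrite /dihedral_factor expr0 invr1 !(hornerZ_int _ 1) -!rmorphM -rmorphB.
  by congr ZtoC; rewrite !hornerPE !horner_geom_poly1 natrM; ring.
apply: eq_big_nat => k kn.
have w1 := prim_pow_neq1 zp kn; have wn := prim_pow_order zp k.
have geom0 w : w != 1 -> w ^+ n = 1 -> (pZtoC (geom_poly _ n)).[w] = 0.
  by move=> w_neq1 wE; rewrite horner_geom_poly geom_sumE // wE subrr mul0r.
have wV1 : (z ^+ k)^-1 != 1 by rewrite invr_eq1.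
have wVn : (z ^+ k)^-1 ^+ n = 1 by rewrite exprVn wn invr1.
by rewrite /dihedral_factor !hornerZE !geom0 // !mulr0 !addr0.
Qed.

Lemma prim_root_odd_exp (s r : nat) (z : algC) : odd r ->
  (2 ^ s).-primitive_root z -> (2 ^ s).-primitive_root (z ^+ r).
Proof.
by move=> odd_r zp; rewrite (prim_root_exp_coprime _ zp) coprimeXr // coprimen2.
Qed.

(** As r is odd, z ^+ r is again a primitive root, so numerator and denominator
have the same product n. *)
Lemma prod_cyclotomic_unit (s r : nat) (z : algC) : odd r -> (2 ^ s).-primitive_root z ->
  \prod_(1 <= k < 2 ^ s) ((1 - (z ^+ k) ^+ r) / (1 - z ^+ k)) = 1.
Proof.
move=> odd_r zp; rewrite prodf_div; under eq_bigr => k _ do rewrite exprAC.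
rewrite (prod_one_sub_prim_pow zp) (prod_one_sub_prim_pow (prim_root_odd_exp odd_r zp)).
by rewrite divff // pnatr_eq0 -lt0n expn_gt0.
Qed.

(** Both polynomials are geometric sums; over the common denominator
|w - 1|^2 the numerators |w^(2m+1) - 1|^2 and |w^(2m) - 1|^2 have a difference
that factors. *)
Lemma dihedral_factor_geom (m : nat) (w : algC) : w != 0 -> w != 1 ->
  dihedral_factor (pZtoC (geom_poly _ m.*2.+1)) (pZtoC (geom_poly _ m.*2)) w =
  (1 - w ^+ (4 * m).+1) / (1 - w) / (w ^+ 2) ^+ m.
Proof.
move=> w0 w1; have wV1 : w^-1 != 1 by rewrite invr_eq1.
have u0 := expf_neq0 m w0.
rewrite /dihedral_factor !horner_geom_poly !geom_sumE //.
rewrite mulnC -[m.*2]muln2 -[(m * 2).+1]addn1 !exprD !expr1 -[(m * 4).+1]addn1 !exprD expr1.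
rewrite ![w ^+ (m * _)]exprM ![w^-1 ^+ (m * _)]exprM [(w ^+ 2) ^+ m]exprAC exprVn.
move: (w ^+ m) u0 => u u0; field.
by rewrite u0 w0 /= !subr_eq0 w1 eq_sym w1.
Qed.

(** The pair of geometric sums with 2 * m0 + 1 and 2 * m0 terms takes the value
4 * m0 + 1; the progression has step 2n = 4 * 2 ^ s, so that m0 only has to
run over the residues modulo 2 ^ s. *)
Lemma dihedral_value_1mod4 (s : nat) (m : int) :
  group_det_value 'D_(2 ^ s.+2) (4 * m + 1).
Proof.
have n_gt1 : (1 < 2 ^ s.+1)%N by rewrite (ltn_exp2l 0).
have [z zp] := C_prim_root_exists (ltnW n_gt1).
have [m0 [t Dm]] : exists (m0 : nat) (t : int), m = m0%:Z + (2 ^ s)%:Z * t.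
  exists `|(m %% (2 ^ s)%:Z)%Z|%N, (m %/ (2 ^ s)%:Z)%Z.
  by rewrite gez0_abs ?modz_ge0 -?lt0n ?expn_gt0 // addrC mulrC -divz_eq.
pose f := geom_poly int m0.*2.+1; pose g := geom_poly int m0.*2.
have DP : \prod_(1 <= k < 2 ^ s.+1) dihedral_factor (pZtoC f) (pZtoC g) (z ^+ k) = ZtoC 1.
  have E k : (1 <= k < 2 ^ s.+1)%N -> dihedral_factor (pZtoC f) (pZtoC g) (z ^+ k) =
      (1 - (z ^+ k) ^+ (4 * m0).+1) / (1 - z ^+ k) / ((z ^+ k) ^+ 2) ^+ m0.
    by move=> kn; rewrite dihedral_factor_geom ?(prim_pow_neq0 zp) ?(prim_pow_neq1 zp).
  rewrite (eq_big_nat _ _ E) prodf_div (prod_cyclotomic_unit _ zp); last first.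
    by rewrite /= oddM.
  by rewrite prodrXl (prod_prim_pow_sqr zp) expr1n divr1.
rewrite expnS; have := dihedral_value_shift t n_gt1 zp DP.
rewrite !horner_geom_poly1 mulr1; congr group_det_value.
by rewrite Dm expnS -muln2 -addn1 !(natrD, natrM) natz; ring.
Qed.

(** At w = 1 the factor is 4 * 2n * m because f(1) = 2 and g(1) = -2, and the
other roots contribute n^2, with n = 2 ^ s.+1. *)
Lemma dihedral_value_pow2 (s : nat) (m : int) :
  group_det_value 'D_(2 ^ s.+2) (2 ^+ (3 * s.+2) * m).
Proof.
have n_gt1 : (1 < 2 ^ s.+1)%N by rewrite (ltn_exp2l 0).
have [z zp] := C_prim_root_exists (ltnW n_gt1).
pose f : {poly int} := 1%:P + 'X * 'X; pose g : {poly int} := - (1%:P + 'X).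
have DP : \prod_(1 <= k < 2 ^ s.+1) dihedral_factor (pZtoC f) (pZtoC g) (z ^+ k)
          = ZtoC ((2 ^ s.+1)%:R ^+ 2).
  have E k : (1 <= k < 2 ^ s.+1)%N -> dihedral_factor (pZtoC f) (pZtoC g) (z ^+ k) =
      (1 - z ^+ k) * (1 - (z ^+ k) ^+ 3) / (z ^+ k) ^+ 2.
    move=> kn; rewrite /dihedral_factor !hornerZE.
    by move: (z ^+ k) (prim_pow_neq0 zp k) => w w0; field.
  rewrite (eq_big_nat _ _ E) prodf_div big_split /= (prod_prim_pow_sqr zp) divr1.
  under [X in _ * X]eq_bigr => k _ do rewrite exprAC.
  rewrite (prod_one_sub_prim_pow zp) (prod_one_sub_prim_pow (prim_root_odd_exp _ zp)) //.
  by rewrite -expr2 rmorphXn rmorph_nat.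
rewrite expnS; have := dihedral_value_shift m n_gt1 zp DP.
rewrite /f /g !hornerPE; congr group_det_value.
rewrite -expnS !natrX -!exprM.
transitivity ((2 : int) ^+ 2 * 2 ^+ s.+2 * 2 ^+ (s.+1 * 2) * m); first by ring.
by rewrite -!exprD; congr (_ ^+ _ * _); lia.
Qed.

Lemma prod_sub_prim_pow (n : nat) (z c : algC) : n.-primitive_root z ->
  \prod_(k < n) (c - z ^+ k) = c ^+ n - 1.
Proof.
move=> zp; rewrite -[RHS](_ : ('X^n - 1).[c] = _); last first.
  by rewrite hornerD hornerXn hornerN hornerC.
rewrite -(factor_Xn_sub_1 zp) horner_prod big_mkord.
by apply: eq_bigr => k _; rewrite hornerXsubC.
Qed.

Lemma dihedral_value_3X (s : nat) :
  group_det_value 'D_(2 ^ s.+2) ((3 ^+ (2 ^ s.+1) - 1) ^+ 2).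
Proof.
have n_gt1 : (1 < 2 ^ s.+1)%N by rewrite (ltn_exp2l 0).
have [z zp] := C_prim_root_exists (ltnW n_gt1).
rewrite [X in 'D_X]expnS; apply/(dihedral_det_value _ n_gt1 zp).
exists (3%:P + 'X), 0.
have zVp : (2 ^ s.+1).-primitive_root z^-1.
  have -> : z^-1 = z ^+ (2 ^ s.+1).-1.
    have z0 := prim_pow_neq0 zp 1; apply: (mulfI z0).
    by rewrite expr1 mulfV // -exprS prednK ?(ltnW n_gt1) // (prim_expr_order zp).
  by apply: prim_root_odd_exp zp; rewrite -subn1 oddB ?(ltnW n_gt1) // oddX.
have prod3 (w : algC) : (2 ^ s.+1).-primitive_root w ->
    \prod_(k < 2 ^ s.+1) (3 + w ^+ k) = 3 ^+ (2 ^ s.+1) - 1.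
  move=> wp; rewrite -[in RHS](opprK 3) exprNn -signr_odd oddX /= expr0 mul1r.
  rewrite -(prod_sub_prim_pow _ wp).
  under [RHS]eq_bigr => k _ do rewrite -opprD.
  by rewrite prodrN card_ord -signr_odd oddX /= expr0 mul1r.
rewrite rmorphXn rmorphB rmorphXn /= rmorph1 -[3%:~R]/(3 : algC).
rewrite expr2 -{1}(prod3 z zp) -(prod3 _ zVp) -big_split /=; apply: eq_bigr => k _.
by rewrite /dihedral_factor rmorph0 !horner0 mul0r subr0 !hornerZE exprVn.
Qed.

(** * Values for the orders 8 and 16 *)

(** Explicit polynomials h make the product over w <> 1 computable by the Graeffe
steps. *)
Lemma dihedral_value_trace (s : nat) (f g h : {poly int}) (t : int) :
  (forall w : algC, w != 0 ->
     dihedral_factor (pZtoC f) (pZtoC g) w = (pZtoC h).[w + w^-1]) ->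
  group_det_value 'D_(2 ^ s.+2)
    ((f.[1] - g.[1]) * (f.[1] + g.[1] + 2 ^+ s.+2 * t) *
     (h.[-2] * \prod_(0 <= j < s) (iter j graeffe h).[0] ^+ 2)).
Proof.
move=> hP; have n_gt1 : (1 < 2 ^ s.+1)%N by rewrite (ltn_exp2l 0).
have [z zp] := C_prim_root_exists (ltnW n_gt1).
have DP := prod_nontrivial_powers h (prim_root_half zp).
rewrite [X in 'D_X]expnS -natrX [X in X%:R]expnS.
apply: (dihedral_value_shift _ n_gt1 zp); rewrite -DP; apply: eq_bigr => k _.
by rewrite hP // (prim_pow_neq0 zp).
Qed.

(** For w a primitive eighth root of unity, w + w^-1 is a square root of 2. *)
Lemma graeffe_sqrt2 (h : {poly int}) (c : algC) : c ^+ 2 = 2 ->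
  ZtoC (graeffe h).[0] = (pZtoC h).[c] * (pZtoC h).[- c].
Proof. by move=> c2; rewrite -horner_graeffe c2 subrr -(hornerZ_int _ 0). Qed.

(** Here f(1) = 4 and the factors at -1 and at the pair of roots of order 4 are
4 and 2^2. *)
Lemma D8_value (t : int) : group_det_value 'D_8 (2 ^+ 8 * (2 * t + 1)).
Proof.
pose f : {poly int} := 2%:P + 'X + 'X * 'X.
pose h : {poly int} := 2%:P + 3%:P * 'X + 2%:P * 'X * 'X.
have hP w : w != 0 -> dihedral_factor (pZtoC f) (pZtoC 0) w = (pZtoC h).[w + w^-1].
  by move=> w0; rewrite /dihedral_factor rmorph0 !horner0 !hornerZE; field.
have := dihedral_value_trace 1 t hP; rewrite big_nat1 /= /f /h horner0 !hornerPE.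
by congr group_det_value; ring.
Qed.

Section D16.
Variables (f g h : {poly int}) (C : int).
Hypothesis hP : forall w : algC, w != 0 ->
  dihedral_factor (pZtoC f) (pZtoC g) w = (pZtoC h).[w + w^-1].
Hypothesis hC : (pZtoC h).[sqrtC 2] * (pZtoC h).[- sqrtC 2] = ZtoC C.

Lemma D16_value_trace (t : int) : group_det_value 'D_16
  ((f.[1] - g.[1]) * (f.[1] + g.[1] + 2 ^+ 4 * t) * (h.[-2] * h.[0] ^+ 2 * C ^+ 2)).
Proof.
have := dihedral_value_trace 2 t hP; rewrite big_nat_recr //= big_nat1 /=.
have -> : (graeffe h).[0] = C.
  by apply: (@intr_inj algC); rewrite (graeffe_sqrt2 _ (sqrtCK 2)).
by congr group_det_value; ring.
Qed.
End D16.

(** The three pairs below have f(1) - g(1) = 4 and a product of absolute value 2^6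
over w <> 1.  The first two have f(1) + g(1) = 4 and products of opposite signs,
which gives both classes of 2^10 times an odd number modulo 2^12; the third has
f(1) + g(1) = 8. *)
Lemma D16_value_10_pos (t : int) : group_det_value 'D_16 (2 ^+ 10 * (4 * t + 1)).
Proof.
pose f : {poly int} := 1%:P + 'X + 'X * 'X + 'X * 'X * 'X * 'X.
pose h : {poly int} := 2%:P - 'X - 2%:P * 'X * 'X + 'X * 'X * 'X + 'X * 'X * 'X * 'X.
have hP w : w != 0 -> dihedral_factor (pZtoC f) (pZtoC 0) w = (pZtoC h).[w + w^-1].
  by move=> w0; rewrite /dihedral_factor rmorph0 !horner0 !hornerZE; field.
have hC : (pZtoC h).[sqrtC 2] * (pZtoC h).[- sqrtC 2] = ZtoC 2.
  rewrite !hornerZE; set c := sqrtC 2; have c2 : c ^+ 2 = 2 := sqrtCK 2.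
  (* the product of the conjugate values is a polynomial in c ^+ 2 *)
  pose q : algC := c ^+ 2.
  transitivity ((2 - 2 * q + q * q) ^+ 2 - q * (q - 1) ^+ 2); first by rewrite /q; ring.
  by rewrite /q c2; ring.
have := D16_value_trace hP hC t; rewrite /f /h horner0 !hornerPE.
by congr group_det_value; ring.
Qed.

Lemma D16_value_10_neg (t : int) : group_det_value 'D_16 (2 ^+ 10 * (4 * t - 1)).
Proof.
pose f : {poly int} := 1%:P + 2%:P * 'X + 'X * 'X.
pose g : {poly int} := 'X * 'X * 'X - 1%:P.
pose h : {poly int} := 2%:P + 'X + 'X * 'X + 'X * 'X * 'X.
have hP w : w != 0 -> dihedral_factor (pZtoC f) (pZtoC g) w = (pZtoC h).[w + w^-1].
  by move=> w0; rewrite /dihedral_factor !hornerZE; field.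
have hC : (pZtoC h).[sqrtC 2] * (pZtoC h).[- sqrtC 2] = ZtoC (-2).
  rewrite !hornerZE; set c := sqrtC 2; have c2 : c ^+ 2 = 2 := sqrtCK 2.
  pose q : algC := c ^+ 2.
  transitivity ((2 + q) ^+ 2 - q * (1 + q) ^+ 2); first by rewrite /q; ring.
  by rewrite /q c2; ring.
have := D16_value_trace hP hC (- t); rewrite /f /g /h !hornerPE.
by congr group_det_value; ring.
Qed.

Lemma D16_value_11 (t : int) : group_det_value 'D_16 (2 ^+ 11 * (2 * t + 1)).
Proof.
pose f : {poly int} := 2%:P + 2%:P * 'X + 2%:P * 'X * 'X.
pose g : {poly int} := 1%:P + 'X.
pose h : {poly int} := 2%:P + 7%:P * 'X + 4%:P * 'X * 'X.
have hP w : w != 0 -> dihedral_factor (pZtoC f) (pZtoC g) w = (pZtoC h).[w + w^-1].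
  by move=> w0; rewrite /dihedral_factor !hornerZE; field.
have hC : (pZtoC h).[sqrtC 2] * (pZtoC h).[- sqrtC 2] = ZtoC 2.
  rewrite !hornerZE; set c := sqrtC 2; have c2 : c ^+ 2 = 2 := sqrtCK 2.
  pose q : algC := c ^+ 2.
  transitivity ((2 + 4 * q) ^+ 2 - q * 7 ^+ 2); first by rewrite /q; ring.
  by rewrite /q c2; ring.
have := D16_value_trace hP hC t; rewrite /f /g /h !hornerPE.
by congr group_det_value; ring.
Qed.

(** * The sets of values *)

(** The values are attained by four linear forms of which three are constant and
the first is 4m plus a constant. *)
Lemma klein_four_values (v : int) : group_det_value klein_four v <->
  [\/ exists m : int, v = 4 * m + 1,
      exists m : int, v = 2 ^+ 4 * (2 * m + 1)
    | exists m : int, v = 2 ^+ 6 * m].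
Proof.
have valueP a b c d : group_det_value klein_four (klein_product a b c d).
  exists (fun g => if g == (0, 0) then a else if g == (1, 0) then b
                   else if g == (0, 1) then c else d).
  by rewrite klein_four_det.
split=> [[x ->]|].
  rewrite klein_four_det; set a := x _; set b := x _; set c := x _; set d := x _.
  have [ev|/klein_product_odd] := boolP (2 %| a + b + c + d)%Z; last by constructor 1.
  by have [|[]] := klein_product_even ev; [constructor 3 | constructor 2].
case=> -[m ->].
- have := valueP (m + 1) m m m; congr group_det_value; rewrite /klein_product; ring.
- have := valueP (m + 2) m m m; congr group_det_value; rewrite /klein_product; ring.
have := valueP (m + 2) m (m - 1) (m - 1); congr group_det_value.
by rewrite /klein_product; ring.
Qed.

Lemma D8_values (v : int) : group_det_value 'D_8 v <->
  (exists m : int, v = 4 * m + 1) \/ (exists m : int, v = 2 ^+ 8 * m).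
Proof.
split=> [/(@dihedral_value_necessary 0)//|[[m ->]|[m ->]]].
  exact: (dihedral_value_1mod4 1).
have [t [->|->]] := int_parity m; last exact: D8_value.
by have := dihedral_value_pow2 1 t; congr group_det_value; ring.
Qed.

(** The multiples of 2^12 come from the general construction, so that only the
odd multiples of 2^10 and 2^11 need pairs of their own. *)
Lemma D16_values (v : int) : group_det_value 'D_16 v <->
  (exists m : int, v = 4 * m + 1) \/ (exists m : int, v = 2 ^+ 10 * m).
Proof.
split=> [/(@dihedral_value_necessary 1)//|[[m ->]|[m ->]]].
  exact: (dihedral_value_1mod4 2).
have [t [->|->]] := int_parity m; have [u [->|->]] := int_parity t.
- by have := dihedral_value_pow2 2 u; congr group_det_value; ring.
- by have := D16_value_11 u; congr group_det_value; ring.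
- by have := D16_value_10_pos u; congr group_det_value; ring.
by have := D16_value_10_neg (u + 1); congr group_det_value; ring.
Qed.

Lemma dihedral_odd_values (s : nat) (v : int) :
  (group_det_value 'D_(2 ^ s.+3) v /\ ~~ (2 %| v)%Z) <-> (v = 1 %[mod 4])%Z.
Proof.
split=> [[/dihedral_value_necessary[[m ->] _|[m ->]]]|v1].
- by lia.
- by rewrite addnS exprS -mulrA dvdz_mulr.
have [m ->] : exists m, v = 4 * m + 1 by exists (v %/ 4)%Z; lia.
by split; [exact: dihedral_value_1mod4 | lia].
Qed.

(** Squaring a power x of 3 multiplies x - 1 by x + 1, which is twice an odd number
when the exponent is even. *)
Lemma three_pow_sub1 (s : nat) : exists q : int,
  3 ^+ (2 ^ s.+1) - 1 = 2 ^+ s.+3 * (2 * q + 1) :> int.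
Proof.
elim: s => [|s [q IHs]]; first by exists 0.
exists (2 ^+ s.+1 * (2 * q + 1) ^+ 2 + q).
rewrite expnSr exprM -[X in X ^+ 2](subrK 1) IHs !(exprS _ s.+3) !(exprS _ s.+2) !(exprS _ s.+1).
by ring.
Qed.

(** The 2-adic valuation of 3^n - 1 for n = 2 ^ s.+2 is s + 4. *)
Lemma dihedral_exact_value (s : nat) : exists v : int,
  [/\ group_det_value 'D_(2 ^ s.+3) v, ((2 : int) ^+ (2 * s + 8) %| v)%Z
    & ~~ ((2 : int) ^+ (2 * s + 9) %| v)%Z].
Proof.
have [q Dq] := three_pow_sub1 s.+1.
exists ((3 ^+ (2 ^ s.+2) - 1) ^+ 2); split; first exact: dihedral_value_3X.
  rewrite Dq exprMn -exprM; apply: dvdz_mulr; apply: dvdz_exp2l; lia.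
have -> : (2 * s + 9 = s.+4 * 2 + 1)%N by lia.
rewrite Dq exprMn -exprM exprD dvdz_mul2l ?expf_neq0 //.
have -> : (2 * q + 1) ^+ 2 = 2 * (2 * q ^+ 2 + 2 * q) + 1 by ring.
by move: (2 * q ^+ 2 + _) => r; lia.
Qed.

Theorem theorem5p3 :
  [/\ forall v : int, group_det_value klein_four v <->
        [\/ exists m : int, v = 4 * m + 1,
            exists m : int, v = 2 ^+ 4 * (2 * m + 1)
          | exists m : int, v = 2 ^+ 6 * m],
      forall v : int, group_det_value 'D_8 v <->
        (exists m : int, v = 4 * m + 1) \/ (exists m : int, v = 2 ^+ 8 * m),
      forall v : int, group_det_value 'D_16 v <->
        (exists m : int, v = 4 * m + 1) \/ (exists m : int, v = 2 ^+ 10 * m)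
    & forall k : nat, (4 <= k)%N ->
      [/\ forall v : int,
            (group_det_value 'D_(2 ^ k) v /\ ~~ (2 %| v)%Z) <->
            (v = 1 %[mod 4])%Z,
          forall m : int, even_group_det_value 'D_(2 ^ k) (2 ^+ (3 * k) * m),
          forall v : int, even_group_det_value 'D_(2 ^ k) v ->
            exists m : int, v = 2 ^+ (2 * k + 2) * m
        & exists v : int,
            [/\ even_group_det_value 'D_(2 ^ k) v,
                ((2 : int) ^+ (2 * k + 2) %| v)%Z
              & ~~ ((2 : int) ^+ (2 * k + 3) %| v)%Z]]].
Proof.
split; [exact: klein_four_values | exact: D8_values | exact: D16_values |].
case=> [|[|[|s]]] // _.
have Dexp : (2 * s.+3 + 2 = 2 * s + 8)%N by lia.
split.
- exact: dihedral_odd_values.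
- move=> m; split; first exact: dihedral_value_pow2.
  by rewrite mulnS exprS -!mulrA dvdz_mulr.
- move=> v [/dihedral_value_necessary[[m ->] ev|[m ->] _]]; first by lia.
  by exists m; rewrite Dexp.
have [v [Dv dvd ndvd]] := dihedral_exact_value s; exists v; rewrite Dexp.
have -> : (2 * s.+3 + 3 = 2 * s + 9)%N by lia.
do ?split=> //; apply: dvdz_trans dvd; rewrite addnS exprS; exact: dvdz_mulr.
Qed.
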